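(* Let $(\mathbf{d^+},\mathbf{d^-})$ be a bi-degree sequence on vertices $v_1,\dots,v_n$ and let $F\subseteq\{v_1,\dots,v_{n-1}\}$ be a forbidden set, with the vertices indexed in $F$-normal order, i.e. $F=\{v_{n-|F|},\dots,v_{n-1}\}$ and for each $i=1,\dots,n-|F|-2$ either $d^-_i>d^-_{i+1}$, or $d^-_i=d^-_{i+1}$ and $d^+_i\ge d^+_{i+1}$. Let $A$ be any $d^+_n$-element subset of $\{v_1,\dots,v_{n-|F|-1}\}$ (a possible out-neighborhood of $v_n$ avoiding $F$). If the $A$-reduced bi-degree sequence $(\mathbf{d^+}|_A,\mathbf{d^-}|_A)$ is bi-graphical, then the $F[d^+_n]$-reduced bi-degree sequence $(\mathbf{d^+}|_{F[d^+_n]},\mathbf{d^-}|_{F[d^+_n]})$ is bi-graphical as well, where $F[d^+_n]=\{v_1,\dots,v_{d^+_n}\}$ is the set of the first $d^+_n$ vertices in the $F$-normal order.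
   Context: A bi-degree sequence is a pair of sequences $(\{d^+_1,\dots,d^+_n\},\{d^-_1,\dots,d^-_n\})$ of nonnegative integers; it is bi-graphical if there is a simple directed graph on $v_1,\dots,v_n$ (no loops, no parallel edges in the same direction; opposite edges $uv$, $vu$ allowed) where $v_j$ has out-degree $d^+_j$ and in-degree $d^-_j$; sequences with a negative entry are not bi-graphical. For a $d^+_n$-element subset $A\subseteq\{v_1,\dots,v_{n-1}\}$, the $A$-reduced sequence is defined by $d^+_k|_A=d^+_k$ for $k\ne n$, $d^+_n|_A=0$, and $d^-_k|_A=d^-_k-1$ if $v_k\in A$, $d^-_k|_A=d^-_k$ otherwise; any index $k$ with $d^+_k|_A=d^-_k|_A=0$ is removed. *)

(* Defs.v *)
From mathcomp Require Import all_boot all_order all_algebra.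

Set Implicit Arguments.
Unset Strict Implicit.
Unset Printing Implicit Defensive.

Import Order.TTheory GRing.Theory Num.Theory.
Local Open Scope ring_scope.

Section Digraphs.

Variable T : finType.

(* A relation has no parallel arcs and allows opposite ones, so simplicity
   amounts to having no loops. *)
Definition simple_digraph (e : rel T) : Prop := irreflexive e.

Definition out_degree (e : rel T) (x : T) : nat := #|[set y | e x y]|.

Definition in_degree (e : rel T) (x : T) : nat := #|[set y | e y x]|.

(* Entries are integers because reducing a sequence may produce -1; a sequence
   with a negative entry is never bigraphical, since degrees are naturals. *)
Definition bigraphical (dp dm : T -> int) : Prop :=
  exists e : rel T,
    simple_digraph e /\
    forall x : T, (out_degree e x)%:Z = dp x /\ (in_degree e x)%:Z = dm x.

End Digraphs.

(* The vertices v_1, ..., v_(n+1) are the elements of 'I_n.+1: v_k has value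
   k - 1, and the distinguished last vertex is ord_max. *)
Section Reduction.

Variables (n : nat) (dp dm : 'I_n.+1 -> nat).

Section ReducedSequence.

Variable A : {set 'I_n.+1}.

Definition reduced_out_full (k : 'I_n.+1) : int :=
  if k == ord_max then 0 else (dp k)%:Z.

Definition reduced_in_full (k : 'I_n.+1) : int :=
  if k \in A then (dm k)%:Z - 1 else (dm k)%:Z.

Definition reduced_index : finType :=
  {k : 'I_n.+1 | ~~ ((reduced_out_full k == 0) && (reduced_in_full k == 0))}.

Definition reduced_out (k : reduced_index) : int := reduced_out_full (val k).

Definition reduced_in (k : reduced_index) : int := reduced_in_full (val k).

Definition reduced_bigraphical : Prop := bigraphical reduced_out reduced_in.

End ReducedSequence.

(* The allowed vertices come first, then those of F, then ord_max. *)
Definition normal_order (F : {set 'I_n.+1}) : Prop :=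
  F = [set k : 'I_n.+1 | (n - #|F| <= k < n)%N] /\
  forall i j : 'I_n.+1, j = i.+1 :> nat -> (j < n - #|F|)%N ->
    (dm j < dm i)%N \/ (dm i = dm j /\ (dp j <= dp i)%N).

End Reduction.

Definition first_vertices (n d : nat) : {set 'I_n.+1} :=
  [set k : 'I_n.+1 | (k < d)%N].

(* Main.v *)
Require Import Defs.
From mathcomp Require Import all_boot all_order all_algebra.
From mathcomp Require Import fingroup perm zify.

(** Any [A] is turned into the initial segment by replacing, one at a time, a
    vertex [j] of [A] by an earlier vertex [i] outside [A].  In a realization of
    the [A]-reduced sequence [i] has larger in-degree than [j].  If some
    [x <> j] has an arc to [i] but not to [j], redirect that arc to [j].
    Otherwise [j -> i] is an arc, [i -> j] is not, and the original in-degrees of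
    [i] and [j] agree, so [i] has at least the out-degree of [j] and there is an
    arc [i -> y] with [j -> y] absent; replace the path [j -> i -> y] by
    [i -> j -> y]. *)

Set Implicit Arguments.
Unset Strict Implicit.
Unset Printing Implicit Defensive.

Section Exchange.

Variable T : finType.
Implicit Types (e : rel T) (x y i j a b : T).

(** Permuting the out-neighbours of [x] by a transposition keeps every out-degree, whatever the arcs
    are. When [x -> a] is an arc and [x -> b] is not, it moves that arc to [b]. *)
Definition redirect e x a b : rel T :=
  fun u v => if u == x then e u (tperm a b v) else e u v.

Lemma redirect_irr e x a b :
  irreflexive e -> e x a -> x != b -> irreflexive (redirect e x a b).
Proof.
move=> irr exa xb u; rewrite /redirect; case: eqP => [->|_]; last exact: irr.
have ax : a != x by apply: contraTneq exa => ->; rewrite irr.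
by rewrite tpermD ?irr // eq_sym.
Qed.

Lemma out_redirect e x a b u : out_degree (redirect e x a b) u = out_degree e u.
Proof.
rewrite /out_degree /redirect; case: (u == x) => //.
rewrite -(card_preimset [set y | e u y] (@perm_inj _ (tperm a b))).
by apply: eq_card => v; rewrite !inE.
Qed.

Lemma in_degreeE e v : in_degree e v = \sum_u e u v.
Proof.
rewrite /in_degree cardsE -sum1_card big_mkcond; apply: eq_bigr => u _.
by rewrite unfold_in; case: (e u v).
Qed.

Lemma in_redirect e x a b v : e x a -> ~~ e x b ->
  in_degree (redirect e x a b) v + (v == a) = in_degree e v + (v == b).
Proof.
move=> exa exb; rewrite !in_degreeE (bigD1 x) //= [in RHS](bigD1 x) //=.
rewrite (eq_bigr (fun u => e u v : nat)); last first.
  by move=> u /negPf ux; rewrite /redirect ux.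
rewrite addnAC [RHS]addnAC; congr (_ + _); rewrite /redirect eqxx.
have ab : a != b by apply: contraNneq exb => <-.
case: tpermP => [->|->|/eqP/negPf-> /eqP/negPf->] //.
  by rewrite exa (negPf exb) eqxx (negPf ab).
by rewrite exa (negPf exb) eqxx eq_sym (negPf ab).
Qed.

Lemma in_degree_exchange e i j :
    irreflexive e -> in_degree e j < in_degree e i ->
    (in_degree e i = (in_degree e j).+1 -> out_degree e j <= out_degree e i) ->
  exists e', [/\ irreflexive e', out_degree e' =1 out_degree e &
    forall v, in_degree e' v + (v == i) = in_degree e v + (v == j)].
Proof.
move=> irr lt_in le_out.
have [/existsP[x /and3P[xj exi exj]]|no_x] :=
    boolP [exists x, [&& x != j, e x i & ~~ e x j]].
  exists (redirect e x i j); split.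
  - exact: redirect_irr.
  - by move=> u; apply: out_redirect.
  - by move=> v; apply: in_redirect.
have sub_in x : x != j -> e x i -> e x j.
  move=> xj exi; apply: contraNT no_x => exj.
  by apply/existsP; exists x; rewrite xj exi.
have sub : [set x | e x i] :\ j \subset [set x | e x j].
  by apply/subsetP => x; rewrite !inE => /andP[]; apply: sub_in.
(* By [sub], the in-degree of [i] exceeds that of [j] by at most one, and only if [j -> i] is an
   arc. The strict inequality [lt_in] forces this extreme case. *)
have card_i := cardsD1 j [set x | e x i]; rewrite inE in card_i.
have le_sub := subset_leq_card sub.
have eji : e j i by move: lt_in; rewrite /in_degree; lia.
have eq_in : in_degree e i = (in_degree e j).+1.
  by move: lt_in; rewrite /in_degree; lia.
have {}sub : [set x | e x i] :\ j = [set x | e x j].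
  by apply/eqP; rewrite eqEcard sub; move: eq_in; rewrite /in_degree; lia.
have eij : ~~ e i j.
  have := in_setD1 i [set x | e x i] j.
  by rewrite sub !inE irr andbF => ->.
have ij : i != j by apply: contraTneq eji => ->; rewrite irr.
(* Since [j -> i] is an arc, removing [i] leaves fewer vertices on the right than the out-degree of
   [i]. *)
have /subsetPn[y] : ~~ ([set y | e i y] \subset [set y | e j y] :\ i).
  apply/negP => /subset_leq_card; have := le_out eq_in; rewrite /out_degree.
  by rewrite (cardsD1 i [set y | e j y]) inE eji; lia.
rewrite !inE => eiy.
have yi : y != i by apply: contraTneq eiy => ->; rewrite irr.
rewrite yi /= => ejy.
have yj : y != j by apply: contraTneq eiy => ->.
(* Two redirections: [j -> i] becomes [j -> y], then [i -> y] becomes [i -> j]. The in-degree of [y]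
   rises and falls back. *)
pose e1 := redirect e j i y; have e1i : e1 i =1 e i.
  by move=> v; rewrite /e1 /redirect (negPf ij).
have irr1 : irreflexive e1 by apply: redirect_irr; rewrite // eq_sym.
exists (redirect e1 i y j); split.
- by apply: redirect_irr; rewrite ?e1i.
- by move=> u; rewrite !out_redirect.
- move=> v; have := in_redirect v eji ejy.
  have := @in_redirect e1 i y j v; rewrite !e1i => /(_ eiy eij).
  by rewrite -/e1; lia.
Qed.

Lemma relpre_val_degrees (P : pred T) e (u : {x | P x}) :
    (forall x y, e x y -> P x && P y) ->
  out_degree (relpre val e) u = out_degree e (val u) /\
  in_degree (relpre val e) u = in_degree e (val u).
Proof.
move=> eP; rewrite /out_degree /in_degree.
split; rewrite -(card_imset _ val_inj); apply: eq_card => y; rewrite inE;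
  apply/imsetP/idP => [[v]|euy]; rewrite ?inE.
- by move=> euv ->.
- by have /andP[_ Py] := eP _ _ euy; exists (Sub y Py); rewrite ?inE ?SubK.
- by move=> euv ->.
- by have /andP[Py _] := eP _ _ euy; exists (Sub y Py); rewrite ?inE ?SubK.
Qed.

Lemma out_degree_gt0 e x y : e x y -> 0 < out_degree e x.
Proof. by move=> exy; apply/card_gt0P; exists y; rewrite inE. Qed.

Lemma in_degree_gt0 e x y : e x y -> 0 < in_degree e y.
Proof. by move=> exy; apply/card_gt0P; exists x; rewrite inE. Qed.

(** Removed indices are exactly the isolated vertices, so all later arguments can use one vertex set
    that does not depend on [A]. *)
Lemma bigraphical_support (dp dm : T -> int) :
  bigraphical (fun k : {k | ~~ ((dp k == 0%R) && (dm k == 0%R))} => dp (val k))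
    (fun k => dm (val k)) <-> bigraphical dp dm.
Proof.
set P := fun k => ~~ ((dp k == 0%R) && (dm k == 0%R)).
split=> [[r [irr deg]]|[e [irr deg]]]; last first.
  have eP x y : e x y -> P x && P y.
    move=> exy; have := out_degree_gt0 exy; have := in_degree_gt0 exy.
    have [dx _] := deg x; have [_ dy] := deg y; rewrite /P.
    by rewrite -dx -dy; lia.
  exists (relpre val e); split=> [u|u]; first exact: irr.
  by have [-> ->] := relpre_val_degrees u eP.
pose e : rel T := fun x y =>
  if insub x is Some u then
    if insub y is Some v then r u v else false
  else false.
have eP x y : e x y -> P x && P y.
  by rewrite /e; case: insubP => // u -> _; case: insubP => // v ->.
have er : relpre val e =2 r by move=> u v; rewrite /e /= !valK.
exists e; split=> [x|x].
  by rewrite /e; case: insubP => // u _ _; apply: irr.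
have [Px|nPx] := boolP (P x).
  have [<- <-] := deg (Sub x Px); have [] := relpre_val_degrees (Sub x Px) eP.
  rewrite SubK => <- <-; rewrite /out_degree /in_degree.
  by split; congr Posz; apply: eq_card => y; rewrite !inE er.
have [-> ->] : out_degree e x = 0 /\ in_degree e x = 0.
  split; apply/eqP; rewrite cards_eq0; apply/eqP/setP => y; rewrite !inE;
  by apply: contraNF nPx => /eP /andP[].
by move: nPx; rewrite negbK => /andP[/eqP-> /eqP->].
Qed.

End Exchange.

Section Reduction.

Variables (n : nat) (dp dm : 'I_n.+1 -> nat).
Implicit Types (A F : {set 'I_n.+1}) (i j : 'I_n.+1).

(** Adding [k \in A] on the left avoids truncated subtraction: a negative reduced entry makes the
    equation unsolvable. *)
Lemma reduced_bigraphicalP A :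
  reduced_bigraphical dp dm A <->
  exists e : rel 'I_n.+1, irreflexive e /\ forall k,
    out_degree e k = (if k == ord_max then 0 else dp k) /\
    in_degree e k + (k \in A) = dm k.
Proof.
rewrite /reduced_bigraphical.
apply: (iff_trans (bigraphical_support _ _)); rewrite /bigraphical.
split=> -[e [irr deg]]; exists e; split=> // k; have := deg k;
  rewrite /reduced_out_full /reduced_in_full;
  case: ifP => _; case: ifP => _ /=; lia.
Qed.

Lemma normal_order_lex F i j :
    normal_order dp dm F -> i < j -> j < n - #|F| ->
  dm j < dm i \/ dm i = dm j /\ dp j <= dp i.
Proof.
move=> [_ step]; case: j => j lt_jn; elim: j lt_jn => // j IHj lt_jn /=.
rewrite ltnS leq_eqVlt => /predU1P[ij|ij] lt_j.
  by apply: step => //=; rewrite ij.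
have := IHj (ltnW lt_jn) ij (ltnW lt_j).
have := step (Ordinal (ltnW lt_jn)) (Ordinal lt_jn) erefl lt_j.
by lia.
Qed.

Lemma reduced_bigraphical_exchange A i j :
    i != ord_max -> j != ord_max -> i \notin A -> j \in A ->
    dm j < dm i \/ dm i = dm j /\ dp j <= dp i ->
  reduced_bigraphical dp dm A -> reduced_bigraphical dp dm (i |: A :\ j).
Proof.
move=> /negPf imax /negPf jmax iA jA lex /reduced_bigraphicalP[e [irr deg]].
have [oi di] := deg i; have [oj dj] := deg j.
rewrite imax (negPf iA) in oi di; rewrite jmax jA in oj dj.
have ij : i != j by apply: contraNneq iA => ->.
(* In [e], the in-degree of [i] is [dm i] and that of [j] is [dm j - 1]. A gap of exactly one thus
   means [dm i = dm j], where [lex] compares the out-degrees. *)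
have [||e' [irr' out' in']] := @in_degree_exchange _ e i j irr; try lia.
apply/reduced_bigraphicalP; exists e'; split=> // k.
have [ok dk] := deg k; rewrite out' ok; split=> //.
rewrite -dk; have := in' k; rewrite !inE.
have [->|ki] := eqVneq k i; first by rewrite (negPf iA) (negPf ij) /=; lia.
by have [->|kj] := eqVneq k j; rewrite ?jA /=; lia.
Qed.

Lemma card_first_vertices d : d <= n.+1 -> #|first_vertices n d| = d.
Proof.
move=> le_d; have inj_widen : injective (widen_ord le_d).
  by move=> k l /(congr1 val) /= /val_inj.
rewrite -[RHS]card_ord -(card_imset _ inj_widen).
apply: eq_card => k; rewrite inE; apply/idP/imsetP => [kd|[l _ ->]].
  by exists (Ordinal kd) => //; apply: val_inj.
exact: (ltn_ord l).
Qed.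

Lemma reduced_bigraphical_first F A :
    normal_order dp dm F -> A \subset first_vertices n (n - #|F|) ->
  reduced_bigraphical dp dm A ->
  reduced_bigraphical dp dm (first_vertices n #|A|).
Proof.
(* Induction on the number of vertices of [A] outside the initial segment of the same size. *)
move=> ordF; have [m] := ubnP #|A :\: first_vertices n #|A| |.
elim: m A => // m IHm A lt_m sAF gA.
set V := first_vertices n #|A|.
have le_A : #|A| <= n - #|F|.
  by rewrite -[leqRHS]card_first_vertices ?subset_leq_card //; lia.
have cV : #|V| = #|A| by rewrite card_first_vertices //; lia.
have [sAV|/subsetPn[j jA jV]] := boolP (A \subset V).
  by have /eqP <- : A == V by rewrite eqEcard sAV cV leqnn.
have /subsetPn[i iV iA] : ~~ (V \subset A).
  apply: contraNN jV => sVA; suff -> : V = A by [].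
  by apply/eqP; rewrite eqEcard sVA cV leqnn.
have := subsetP sAF j jA; rewrite inE => lt_j.
move: (iV) (jV); rewrite !inE -leqNgt => lt_i le_j.
have ij : i < j := leq_trans lt_i le_j.
have cA' : #|i |: A :\ j| = #|A|.
  by rewrite cardsU1 !inE (negPf iA) andbF (cardsD1 j A) jA.
(* The swap preserves the cardinality, hence the target [V]. The measure drops because [j] lies
   outside [V] and [i] inside. *)
rewrite /V -cA'; apply: IHm.
- rewrite cA' -/V; rewrite ltnS in lt_m; apply: leq_trans lt_m.
  apply: proper_card; apply/properP; split.
    apply/subsetP => k; rewrite !in_setD in_setU1 in_setD1.
    by have [->|_] := eqVneq k i; [rewrite iV | case/and3P=> -> _ ->].
  exists j; rewrite in_setD ?jA ?(negPf jV) //.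
  by rewrite in_setU1 in_setD1 eqxx /= orbF -val_eqE /= gtn_eqF.
- apply/subsetP => k; rewrite in_setU1 in_setD1 => /predU1P[->|/andP[_]].
    by rewrite inE; lia.
  exact: (subsetP sAF).
- apply: reduced_bigraphical_exchange => //;
    last exact: normal_order_lex ordF ij lt_j.
    by apply: contraTneq ij => ->; rewrite -leqNgt -ltnS.
  by apply: contraTneq lt_j => -> /=; lia.
Qed.

End Reduction.

Theorem theorem4 (n : nat) (dp dm : 'I_n.+1 -> nat) (F A : {set 'I_n.+1})
    (hF : F \subset [set k : 'I_n.+1 | k != ord_max])
    (hFn : normal_order dp dm F)
    (hA : A \subset first_vertices n (n - #|F|))
    (hAc : #|A| = dp ord_max) :
  reduced_bigraphical dp dm A ->
  reduced_bigraphical dp dm (first_vertices n (dp ord_max)).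
Proof. by rewrite -hAc; apply: reduced_bigraphical_first hFn hA. Qed.
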